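(* Let $d\ge 2$ and let $\mathcal{E}\subset \mathbb{S}^{d-1}$ be a set of directions such that $\operatorname{span}(\mathcal{E})=\mathbb{R}^d$ and $\overline{\mathcal{E}\cup(-\mathcal{E})}\neq \mathbb{S}^{d-1}$. Then there exists a convex body $K\subset\mathbb{R}^d$ such that $w_r(K;\mathcal{E})_\infty=\infty$ for all $r\in\mathbb{N}$.
   Context: Notation. $\|\cdot\|$ is the Euclidean norm, $\mathbb{S}^{d-1}=\{x\in\mathbb{R}^d:\|x\|=1\}$, $\mathbb{N}=\{1,2,\dots\}$. A convex body in $\mathbb{R}^d$ is a compact convex subset with nonempty interior. For $0<p<\infty$, $L^p(\Omega)$ is the usual Lebesgue space; $L^\infty(\Omega):=C(\overline{\Omega})$ with the uniform norm. For a nonempty bounded measurable set $\Omega\subset\mathbb{R}^d$, $h\in\mathbb{R}^d\setminus\{0\}$ and $r\in\mathbb{N}$ put $\Omega_{r,h}:=\{x\in\Omega: x,x+h,\dots,x+rh\in\Omega\}$ and $\triangle_h^r f(x):=\sum_{j=0}^r(-1)^{r+j}\binom{r}{j}f(x+jh)$ for $x\in\Omega_{r,h}$. For $\xi\in\mathbb{S}^{d-1}$, $t>0$, $0<p\le\infty$ let $\omega_\xi^r(f,t)_{L^p(\Omega)}:=\sup_{|u|\le t}\|\triangle_{u\xi}^rf\|_{L^p(\Omega_{r,u\xi})}$ (the norm over an empty set is $0$). For a nonempty $\mathcal{E}\subset\mathbb{S}^{d-1}$ let $\omega^r_{\mathcal{E}}(f;\Omega)_p:=\sup_{\xi\in\mathcal{E}}\omega^r_\xi(f,\operatorname{diam}(\Omega))_{L^p(\Omega)}$.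 $\Pi^d_{r-1}(\mathcal{E})$ is the set of all real continuous functions $Q$ on $\mathbb{R}^d$ such that for every fixed $x\in\mathbb{R}^d$ and $\xi\in\mathcal{E}$ the function $t\mapsto Q(x+t\xi)$ is an algebraic polynomial of degree $<r$ in $t\in\mathbb{R}$. Set $E_r(f;\mathcal{E})_{L^p(\Omega)}:=\inf\{\|f-Q\|_{L^p(\Omega)}:Q\in\Pi^d_{r-1}(\mathcal{E})\}$. The directional Whitney constant is $w_r(\Omega;\mathcal{E})_p:=\sup\{E_r(f;\mathcal{E})_{L^p(\Omega)}: f\in L^p(\Omega),\ \omega^r_{\mathcal{E}}(f;\Omega)_p\le 1\}\in[0,\infty]$. *)

(* Defs.v *)
From HB Require Import structures.
From mathcomp Require Import all_boot all_order all_algebra.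
From mathcomp Require Import all_classical all_reals all_analysis.

Set Implicit Arguments.
Unset Strict Implicit.
Unset Printing Implicit Defensive.

Import Order.TTheory GRing.Theory Num.Theory.
Import numFieldNormedType.Exports.

Local Open Scope classical_set_scope.
Local Open Scope ring_scope.

(* R^d is 'rV[R]_d. The library norm `|x| on row vectors is the sup norm, so
   the Euclidean norm is defined here; the two induce the same topology, so
   closure, interior, compact and continuous are the library notions. *)
Definition enorm (R : realType) (d : nat) (x : 'rV[R]_d) : R :=
  Num.sqrt (\sum_(i < d) x 0 i ^+ 2).

Definition sphere (R : realType) (d : nat) : set 'rV[R]_d :=
  [set x | enorm x = 1].

Definition diam (R : realType) (d : nat) (Omega : set 'rV[R]_d) : R :=
  sup [set enorm (x - y) | x in Omega & y in Omega].

Definition convex_body (R : realType) (d : nat) (K : set 'rV[R]_d) : Prop :=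
  [/\ compact K, convex_set K & interior K !=set0].

Definition lin_span (R : realType) (d : nat) (E : set 'rV[R]_d) :
    set 'rV[R]_d :=
  [set x | exists2 s : seq 'rV[R]_d, [set` s] `<=` E & x \in span s].

(* Only the exponent p = oo is considered: L^oo(Omega) is C(closure Omega).
   An element of it is represented by a function on all of R^d whose values
   outside closure Omega are irrelevant. *)
Definition Linfty (R : realType) (d : nat) (Omega : set 'rV[R]_d) :
    set ('rV[R]_d -> R) :=
  [set f | {within closure Omega, continuous f}].

(* The element 0 makes the norm over the empty set equal to 0. *)
Definition Linfty_norm (R : realType) (d : nat) (Omega : set 'rV[R]_d)
    (f : 'rV[R]_d -> R) : \bar R :=
  ereal_sup (0%E |` [set (`|f x|)%:E | x in closure Omega]).

Definition diff_dom (R : realType) (d : nat) (Omega : set 'rV[R]_d)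
    (r : nat) (h : 'rV[R]_d) : set 'rV[R]_d :=
  [set x | forall j : nat, (j <= r)%N -> Omega (x + j%:R *: h)].

Definition fin_diff (R : realType) (d : nat) (r : nat) (h : 'rV[R]_d)
    (f : 'rV[R]_d -> R) (x : 'rV[R]_d) : R :=
  \sum_(0 <= j < r.+1) (-1) ^+ (r + j) * 'C(r, j)%:R * f (x + j%:R *: h).

(* The value u = 0 contributes 0, since fin_diff r 0 f = 0 for r >= 1. *)
Definition dir_modulus (R : realType) (d : nat) (Omega : set 'rV[R]_d)
    (r : nat) (xi : 'rV[R]_d) (f : 'rV[R]_d -> R) (t : R) : \bar R :=
  ereal_sup [set Linfty_norm (diff_dom Omega r (u *: xi))
                             (fin_diff r (u *: xi) f)
            | u in [set u : R | `|u| <= t]].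

Definition set_modulus (R : realType) (d : nat) (Omega : set 'rV[R]_d)
    (E : set 'rV[R]_d) (r : nat) (f : 'rV[R]_d -> R) : \bar R :=
  ereal_sup [set dir_modulus Omega r xi f (diam Omega) | xi in E].

(* Pi^d_{r-1}(E); size q <= r means degree < r. *)
Definition dir_poly (R : realType) (d : nat) (E : set 'rV[R]_d) (r : nat) :
    set ('rV[R]_d -> R) :=
  [set Q | continuous Q /\
    forall x xi : 'rV[R]_d, E xi ->
      exists2 q : {poly R}, (size q <= r)%N &
        forall t : R, Q (x + t *: xi) = q.[t]].

Definition best_approx (R : realType) (d : nat) (Omega : set 'rV[R]_d)
    (E : set 'rV[R]_d) (r : nat) (f : 'rV[R]_d -> R) : \bar R :=
  ereal_inf [set Linfty_norm Omega (fun x => f x - Q x) | Q in dir_poly E r].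

Definition whitney_const (R : realType) (d : nat) (Omega : set 'rV[R]_d)
    (E : set 'rV[R]_d) (r : nat) : \bar R :=
  ereal_sup [set best_approx Omega E r f
            | f in [set f | Linfty Omega f /\
                            (set_modulus Omega E r f <= 1%:E)%E]].

(* Main.v *)
(* Pick a unit vector [e] away from the closure of [E] and [-E], and let [K] be
   a cone with tip [0] and axis [e], so narrow that every direction in [E]
   leaves it: on a chord of [K] parallel to [E] the height [dot x e] varies by
   a factor at most [2]. Hence [ln (dot x e + eta)] oscillates by at most [1]
   on such chords and its [r]-th differences are bounded uniformly in
   [eta > 0], while its value [ln eta] at the tip is arbitrarily negative and
   it stays bounded far from the tip. A function in [dir_poly E r] cannot
   follow it: as [E] spans, univariate extrapolation successively along
   directions of [E] controls its value at the tip by its maximum on a small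
   ball inside [K], with a constant independent of [eta]. *)
Require Import Defs.
From HB Require Import structures.
From mathcomp Require Import all_boot all_order all_algebra.
From mathcomp Require Import all_classical all_reals all_analysis.
From mathcomp Require Import ring lra.

Set Implicit Arguments.
Unset Strict Implicit.
Unset Printing Implicit Defensive.

Import Order.TTheory GRing.Theory Num.Theory.
Import numFieldNormedType.Exports.

Local Open Scope classical_set_scope.
Local Open Scope ring_scope.

(** * Extrapolation of polynomials along directions *)

(** Induction on [r]: the quotient [g] of [q - q.[a]] by ['X - a] has smaller degree, and on the
    right half of the interval, away from [a], it is at most [2 / (m - a) * B] in absolute value.
    [C] is fixed before [q] and [B]. *)
Lemma poly_extrapolation (R : realFieldType) (r : nat) (a b t : R) : a < b ->
  exists2 C : R, 0 <= C &
    forall (q : {poly R}) (B : R), (size q <= r)%N ->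
      (forall s, a <= s <= b -> `|q.[s]| <= B) -> `|q.[t]| <= C * B.
Proof.
elim: r a b t => [|r IHr] a b t ab.
  exists 0 => // q B; rewrite leqn0 size_poly_eq0 => /eqP -> _.
  by rewrite horner0 normr0 mul0r.
pose m := (a + b) / 2; have mb : m < b by rewrite /m; lra.
have am : 0 < m - a by rewrite /m; lra.
have [C C0 hC] := IHr m b t mb.
have K0 : 0 <= `|t - a| * (C * (2 / (m - a))).
  by rewrite !mulr_ge0// invr_ge0 ltW.
exists (`|t - a| * (C * (2 / (m - a))) + 1) => [|q B sq qB].
  exact: addr_ge0.
have qa : `|q.[a]| <= B by apply: qB; rewrite lexx ltW.
have /factor_theorem[g gE] : root (q - q.[a]%:P) a.
  by rewrite /root !hornerE subrr.
have qE s : q.[s] = g.[s] * (s - a) + q.[a].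
  by have := congr1 (horner^~ s) gE; rewrite !hornerE => <-; rewrite subrK.
have sg : (size g <= r)%N.
  have [->|g0] := eqVneq g 0; first by rewrite size_poly0.
  have := size_polyD q (- q.[a]%:P).
  rewrite gE size_Mmonic ?monicXsubC//.
  rewrite size_XsubC addn2 /= size_polyN size_polyC -[(size g <= r)%N]ltnS.
  move=> /leq_trans; apply.
  by rewrite geq_max sq; case: (_ != 0).
have gB s : m <= s <= b -> `|g.[s]| <= 2 / (m - a) * B.
  move=> /andP[ms sb]; have sa : 0 < s - a by lra.
  have : `|g.[s]| * (s - a) <= 2 * B.
    rewrite -[X in _ * X](gtr0_norm sa) -normrM.
    rewrite (_ : _ * _ = q.[s] - q.[a]); last by rewrite (qE s) addrK.
    apply: le_trans (ler_normB _ _) _; rewrite mulr2n mulrDl !mul1r lerD//.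
    by apply: qB; rewrite sb andbT; lra.
  move=> h; rewrite mulrAC ler_pdivlMr//; apply: le_trans h.
  by rewrite ler_wpM2l//; lra.
rewrite qE mulrDl mul1r (le_trans (ler_normD _ _))// lerD// normrM.
by rewrite mulrC -mulrA ler_wpM2l// -mulrA hC.
Qed.

(** Each [x] near [p + c *: xi] lies on a line parallel to [xi] that meets the ball about [p] in a
    segment of uniform length; the restriction of [Q] to this line is extrapolated from that
    segment. *)
Lemma dir_poly_bound_shift1 (R : realType) (d r : nat) (E : set 'rV[R]_d)
    (p xi : 'rV[R]_d) (c rho : R) : E xi -> 0 < rho ->
  exists2 C : R, 0 <= C &
    forall (Q : 'rV[R]_d -> R) (B : R), dir_poly E r Q ->
      (forall x, `|x - p| < rho -> `|Q x| <= B) ->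
      forall x, `|x - (p + c *: xi)| < rho / 2 -> `|Q x| <= C * B.
Proof.
(* Displacements [u *: xi] with [|u| <= s] use up at most half of the radius [rho]; the summand 1
   keeps the divisor positive. *)
move=> Exi rho0; pose s := rho / 2 / (`|xi| + 1).
have xi1 : 0 < `|xi| + 1 by rewrite ltr_wpDl.
have s0 : 0 < s by rewrite !divr_gt0.
have [C C0 hC] := @poly_extrapolation R r (- s) s c ltac:(lra).
exists C => // Q B [_ Qp] QB x xp.
have [q sq qE] := Qp (x - c *: xi) xi Exi.
rewrite -[x](subrK (c *: xi)) qE; apply: hC => // u us; rewrite -qE.
apply: QB; rewrite -addrA addrAC addrA.
rewrite (_ : _ + _ = (x - (p + c *: xi)) + u *: xi); last first.
  by rewrite opprD !addrA addrAC -!addrA; congr (_ + _); rewrite addrCA addrC addrA.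
apply: le_lt_trans (ler_normD _ _) _; rewrite [ltRHS](splitr rho) ltr_leD//.
rewrite normrZ (@le_trans _ _ (s * (`|xi| + 1)))//; last first.
  by rewrite divfK// gt_eqF.
by apply: ler_pM => //; [rewrite ler_norml|rewrite lerDl].
Qed.

(** The translation by [v] is split into successive translations along members of [s]; the constants
    multiply and the radius halves each time. *)
Lemma dir_poly_bound_shift (R : realType) (d r : nat) (E : set 'rV[R]_d)
    (s : seq 'rV[R]_d) (v p : 'rV[R]_d) (rho : R) :
  [set` s] `<=` E -> v \in span s -> 0 < rho ->
  exists C rho' : R, [/\ 0 <= C, 0 < rho' &
    forall (Q : 'rV[R]_d -> R) (B : R), dir_poly E r Q ->
      (forall x, `|x - p| < rho -> `|Q x| <= B) ->
      forall x, `|x - (p + v)| < rho' -> `|Q x| <= C * B].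
Proof.
elim: s v p rho => [|xi s IHs] v p rho sE.
  rewrite span_nil memv0 => /eqP -> rho0; exists 1, rho; split => // Q B _ QB x.
  by rewrite addr0 mul1r; exact: QB.
rewrite span_cons => /memv_addP[_ /vlineP[c ->] [w ws ->]] rho0.
have Exi : E xi by apply: sE; rewrite /= mem_head.
have [C1 C10 h1] := dir_poly_bound_shift1 r p c Exi rho0.
have sE' : [set` s] `<=` E by move=> y ys; apply: sE; rewrite /= inE ys orbT.
have [C2 [rho' [C20 rho'0 h2]]] :=
  IHs w (p + c *: xi) (rho / 2) sE' ws (divr_gt0 rho0 (ltr0Sn R 1)).
exists (C2 * C1), rho'; split=> [|//|Q B Qp QB x]; first exact: mulr_ge0.
by rewrite addrA -mulrA; apply: h2 => //; exact: h1.
Qed.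

(** * Euclidean geometry relative to a unit axis *)

Definition dot (R : realType) (d : nat) (x y : 'rV[R]_d) : R :=
  \sum_(i < d) x 0 i * y 0 i.

Definition perp (R : realType) (d : nat) (e x : 'rV[R]_d) : 'rV[R]_d :=
  x - dot x e *: e.

Section Euclidean.
Variables (R : realType) (d : nat).
Implicit Types (x y z e : 'rV[R]_d) (a : R).

Lemma dotC x y : dot x y = dot y x.
Proof. by apply: eq_bigr => i _; rewrite mulrC. Qed.

Lemma dotDl x y z : dot (x + y) z = dot x z + dot y z.
Proof.
by rewrite /dot -big_split; apply: eq_bigr => i _; rewrite mxE mulrDl.
Qed.

Lemma dotZl a x z : dot (a *: x) z = a * dot x z.
Proof. by rewrite /dot mulr_sumr; apply: eq_bigr => i _; rewrite mxE mulrA. Qed.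

Lemma dot0l z : dot 0 z = 0.
Proof. by rewrite -(scale0r 0) dotZl mul0r. Qed.

Lemma dotxx x : dot x x = enorm x ^+ 2.
Proof.
rewrite sqr_sqrtr; first by apply: eq_bigr => i _; rewrite expr2.
by apply: sumr_ge0 => i _; exact: sqr_ge0.
Qed.

Lemma continuous_dot z : continuous (fun x => dot x z).
Proof.
have h (i : 'I_d) : true -> continuous (fun x : 'rV[R]_d => x 0 i * z 0 i).
  by move=> _ x; exact: (cvgM (@coord_continuous R 1 d 0 i x) (cvg_cst _)).
exact: (continuous_big (@add_continuous R^o) h).
Qed.

Lemma continuous_perp e : continuous (perp e).
Proof.
move=> x; have h := @cvgZr_tmp R 'rV[R]_d _ (nbhs x) _ _ _ e (@continuous_dot e x).
exact: (@cvgB R 'rV[R]_d _ (nbhs x) _ _ _ _ _ cvg_id (h _)).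
Qed.

Lemma continuous_norm_perp e : continuous (fun x => `|perp e x|).
Proof. by move=> x; exact: (cvg_norm (@continuous_perp e x)). Qed.

Lemma perpD e x y : perp e (x + y) = perp e x + perp e y.
Proof. by rewrite /perp dotDl scalerDl opprD addrACA. Qed.

Lemma perpZ e a x : perp e (a *: x) = a *: perp e x.
Proof. by rewrite /perp dotZl -scalerA scalerBr. Qed.

Lemma le_coord_norm x i : `|x 0 i| <= `|x|.
Proof.
rewrite [leRHS]/Num.Def.normr /= mx_normrE.
exact: (le_bigmax _ (fun ij => `|x ij.1 ij.2|) (0, i)).
Qed.

Lemma norm_le_enorm x : `|x| <= enorm x.
Proof.
rewrite [leLHS]/Num.Def.normr /= mx_normrE; apply/bigmax_leP; split=> [|[i j] _ /=].
  exact: sqrtr_ge0.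
rewrite ord1 -sqrtr_sqr ler_wsqrtr// (bigD1 j)//= lerDl.
by apply: sumr_ge0 => k _; exact: sqr_ge0.
Qed.

Lemma dotxx_le_norm x : dot x x <= d%:R * `|x| ^+ 2.
Proof.
have -> : d%:R * `|x| ^+ 2 = \sum_(i < d) `|x| ^+ 2.
  by rewrite sumr_const card_ord mulr_natl.
apply: ler_sum => i _.
by rewrite -expr2 -real_normK ?num_real// lerXn2r ?nnegrE// le_coord_norm.
Qed.

Lemma pythagoras e x : enorm e = 1 ->
  dot x x = dot x e ^+ 2 + dot (perp e x) (perp e x).
Proof.
move=> e1; have ee : dot e e = 1 by rewrite dotxx e1 expr1n.
have dotNl y z : dot (- y) z = - dot y z by rewrite -scaleN1r dotZl mulN1r.
rewrite {2}/perp dotDl dotNl dotZl !(dotC _ (perp e x)) /perp !dotDl !dotNl.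
by rewrite !dotZl ee (dotC e x); ring.
Qed.

Lemma closed_sphere : closed (@sphere R d).
Proof.
rewrite (_ : @sphere R d = (fun x => dot x x) @^-1` [set 1]); last first.
  apply/seteqP; split => x; rewrite /sphere /= dotxx; first by move->; rewrite expr1n.
  by move/eqP; rewrite sqrp_eq1 ?sqrtr_ge0// => /eqP.
apply: closed_comp; last exact: (@closed_eq R 1).
have h (i : 'I_d) : true -> continuous (fun x : 'rV[R]_d => x 0 i * x 0 i).
  by move=> _ x; have h := @coord_continuous R 1 d 0 i x; exact: (cvgM h h).
by move=> x _; exact: (continuous_big (@add_continuous R^o) h).
Qed.

(** A unit vector whose part perpendicular to [e] is too small has [|dot x e|] close to 1 by
    Pythagoras, so it lies within [delta] of [e] or [- e]. *)
Lemma perp_lower_bound e (delta : R) : enorm e = 1 -> 0 < delta ->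
  exists2 c : R, 0 < c & forall x, enorm x = 1 ->
    delta <= `|x - e| -> delta <= `|x + e| -> c * `|dot x e| <= `|perp e x|.
Proof.
move=> e1 delta0; have d0 : 0 <= d%:R :> R by [].
(* With this choice [c + d * c = delta - c * delta < delta], where [c] will bound [n] and [d * c]
   will bound [1 - a ^+ 2]. *)
pose c := delta / (delta + d%:R + 1).
have D0 : 0 < delta + d%:R + 1 by lra.
have c0 : 0 < c by exact: divr_gt0.
have cE : c * (delta + d%:R + 1) = delta by rewrite divfK// gt_eqF.
exists c => // x x1 dm dp; rewrite leNgt; apply/negP => xc.
have en : `|e| <= 1 by rewrite -e1 norm_le_enorm.
set a := dot x e in xc; set n := `|perp e x| in xc.
have n0 : 0 <= n := normr_ge0 _.
have pE : 1 = a ^+ 2 + dot (perp e x) (perp e x).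
  by rewrite -(pythagoras x e1) dotxx x1 expr1n.
have pn := dotxx_le_norm (perp e x); rewrite -/n in pn.
have nn0 : 0 <= dot (perp e x) (perp e x) by rewrite dotxx sqr_ge0.
have a1 : `|a| <= 1.
  rewrite -(@expr_le1 _ 2)// real_normK ?num_real//.
  lra.
have nc : n <= c.
  by rewrite (le_trans (ltW xc))// ler_piMr// ltW.
have c1 : c <= 1 by rewrite ler_pdivrMr// mul1r -addrA lerDl addr_ge0.
have small : n + (1 - a ^+ 2) < delta.
  have n2 : n ^+ 2 <= n by rewrite expr2 ler_piMr// (le_trans nc).
  have dn2 : d%:R * n ^+ 2 <= d%:R * n by rewrite ler_wpM2l.
  have dn : d%:R * n <= d%:R * c by rewrite ler_wpM2l.
  have cd : 0 < c * delta by exact: mulr_gt0.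
  move: cE; rewrite !mulrDr mulr1 [c * _%:R]mulrC; lra.
(* Here [b] is the sign of [a], and [|a - b| = 1 - |a| <= 1 - a ^+ 2]. *)
have close b : b ^+ 2 = 1 -> a * b = `|a| -> delta <= `|x - b *: e| -> False.
  move=> b2 ab; rewrite leNgt => /negP; apply.
  rewrite (_ : x - b *: e = perp e x + (a - b) *: e); last first.
    by rewrite /perp scalerBl addrA subrK.
  apply: le_lt_trans (ler_normD _ _) _; rewrite normrZ -/n.
  apply: le_lt_trans small; rewrite lerD2l (@le_trans _ _ `|a - b|)//.
    by rewrite ler_piMr.
  have := normr_ge0 a; rewrite -[a ^+ 2]real_normK ?num_real// => h.
  have b1 : `|b| = 1 by apply/eqP; rewrite -sqrp_eq1// real_normK ?num_real// b2.
  rewrite (_ : `|a - b| = 1 - `|a|); first by nra.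
  rewrite -[LHS]mulr1 -{1}b1 -normrM mulrBl ab -expr2 b2 distrC.
  by rewrite ger0_norm// subr_ge0.
have [a0|a0] := leP 0 a.
  by apply: (close 1); rewrite ?scale1r ?mulr1 ?expr1n ?ger0_norm.
apply: (close (- 1)); rewrite ?scaleN1r ?opprK ?mulrN1 ?sqrrN ?expr1n//.
by rewrite ltr0_norm.
Qed.

End Euclidean.

(** * Finite differences and the modulus of smoothness *)

(** The signed binomial coefficients sum to 0 for [r > 0], so [f x] may be subtracted from every
    value of [f]; their absolute values sum to [2 ^+ r]. *)
Lemma fin_diff_bound (R : realType) (d r : nat) (h x : 'rV[R]_d)
    (f : 'rV[R]_d -> R) (B : R) : (0 < r)%N ->
  (forall j : nat, (j <= r)%N -> `|f (x + j%:R *: h) - f x| <= B) ->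
  `|fin_diff r h f x| <= 2 ^+ r * B.
Proof.
move=> r0 fB; have alt0 : \sum_(j < r.+1) (-1) ^+ (r + j) * 'C(r, j)%:R = 0 :> R.
  transitivity ((-1) ^+ r * (1 - 1) ^+ r : R).
    rewrite exprBn mulr_sumr; apply: eq_bigr => j _.
    by rewrite !expr1n !mulr1 exprD -mulrA mulr_natr.
  by rewrite subrr expr0n gtn_eqF// mulr0.
have -> : fin_diff r h f x = \sum_(j < r.+1)
    (-1) ^+ (r + j) * 'C(r, j)%:R * (f (x + j%:R *: h) - f x).
  under [RHS]eq_bigr do rewrite mulrBr.
  by rewrite sumrB -mulr_suml alt0 mul0r subr0 /fin_diff big_mkord.
have -> : 2 ^+ r * B = \sum_(j < r.+1) 'C(r, j)%:R * B.
  rewrite -mulr_suml; congr (_ * _); rewrite -[2]/(1 + 1) exprDn.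
  by apply: eq_bigr => j _; rewrite !expr1n mulr1.
apply: le_trans (ler_norm_sum _ _ _) _; apply: ler_sum => j _.
rewrite !normrM normrX normrN1 expr1n mul1r normr_nat ler_wpM2l//.
by apply: fB; rewrite -ltnS.
Qed.

(** [Linfty_norm] takes its supremum over a closure; closedness ensures that the points met there
    still have all their translates in [K]. *)
Lemma closed_diff_dom (R : realType) (d r : nat) (h : 'rV[R]_d)
    (K : set 'rV[R]_d) : closed K -> closed (diff_dom K r h).
Proof.
move=> Kcl x xcl j jr; apply: Kcl => U /= Ux.
have tr : (fun y : 'rV[R]_d => y + j%:R *: h) @ x --> x + j%:R *: h.
  exact: (@cvgD R 'rV[R]_d _ (nbhs x) _ _ _ _ _ cvg_id (cvg_cst _)).
have [y [yK yU]] := xcl _ (tr _ Ux).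
by exists (y + j%:R *: h); split => //; exact: yK.
Qed.

Lemma set_modulus_le1 (R : realType) (d r : nat) (E K : set 'rV[R]_d)
    (f : 'rV[R]_d -> R) : (0 < r)%N -> closed K ->
  (forall x xi (u : R), K x -> E xi -> K (x + u *: xi) ->
    `|f (x + u *: xi) - f x| <= (2 ^+ r)^-1) ->
  (set_modulus K E r f <= 1%:E)%E.
Proof.
move=> r0 Kcl fK; apply: ge_ereal_sup => _ [xi Exi <-].
apply: ge_ereal_sup => _ [u _ <-].
apply: ge_ereal_sup => y [->|[x /(closed_diff_dom Kcl) xK <-]].
  by rewrite lee_fin.
rewrite lee_fin -[leRHS](@divff _ (2 ^+ r : R)) ?expf_neq0//.
apply: fin_diff_bound => // j jr; rewrite scalerA; apply: fK => //.
  by have := xK 0 (leq0n _); rewrite scale0r addr0.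
by rewrite -scalerA; exact: xK.
Qed.

(** * The truncated cone *)

Definition cone (R : realType) (d : nat) (e : 'rV[R]_d) (k : R) :
    set 'rV[R]_d :=
  [set x | dot x e <= 1 /\ `|perp e x| <= k * dot x e].

Lemma cone_ge0 (R : realType) (d : nat) (e x : 'rV[R]_d) (k : R) :
  0 < k -> cone e k x -> 0 <= dot x e.
Proof. by move=> k0 [_ /(le_trans (normr_ge0 _))]; rewrite pmulr_rge0. Qed.

Lemma cone_tip (R : realType) (d : nat) (e : 'rV[R]_d) (k : R) : cone e k 0.
Proof. by rewrite /cone /= /perp dot0l scale0r subr0 normr0 mulr0 ler01. Qed.

(** All inequalities are strict at the axis point of height 1/2. This gives both an interior point
    of the cone and a ball, away from the tip, to extrapolate from. *)
Lemma cone_near (R : realType) (d : nat) (e : 'rV[R]_d) (k : R) :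
  enorm e = 1 -> 0 < k ->
  \forall x \near (2^-1 *: e), cone e k x /\ 4^-1 < dot x e.
Proof.
move=> e1 k0; set p := _ *: e.
have pe : dot p e = 2^-1 by rewrite dotZl dotxx e1 expr1n mulr1.
have pp : perp e p = 0 by rewrite /perp pe subrr.
have h1 : \forall x \near p, dot x e < 1.
  by apply: cvgr_lt (@continuous_dot _ _ e p) _ _; rewrite pe; lra.
have h2 : \forall x \near p, 4^-1 < dot x e.
  by apply: cvgr_gt (@continuous_dot _ _ e p) _ _; rewrite pe; lra.
have h3 : \forall x \near p, `|perp e x| < k / 4.
  apply: cvgr_lt (@continuous_norm_perp _ _ e p) _ _.
  by rewrite pp normr0 divr_gt0.
near=> x; have [h4 h5 h6] : [/\ dot x e < 1, 4^-1 < dot x e & `|perp e x| < k / 4].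
  by split; near: x.
split=> //; split; first exact: ltW.
by apply: ltW; rewrite (lt_trans h6)// ltr_pM2l.
Unshelve. all: by end_near. Qed.

Lemma closed_cone (R : realType) (d : nat) (e : 'rV[R]_d) (k : R) :
  closed (cone e k).
Proof.
rewrite (_ : cone e k = (fun x => dot x e) @^-1` [set y | y <= 1] `&`
    (fun x => k * dot x e - `|perp e x|) @^-1` [set y | 0 <= y]); last first.
  by apply/seteqP; split => x [h1 h2]; split => //; move: h2; rewrite /= subr_ge0.
apply: closedI; apply: closed_comp.
- by move=> x _; exact: continuous_dot.
- exact: closed_le.
- move=> x _; apply: cvgB (@continuous_norm_perp _ _ e x).
  exact: (cvgM (cvg_cst k) (@continuous_dot _ _ e x)).
- exact: closed_ge.
Qed.

Lemma convex_body_cone (R : realType) (d : nat) (e : 'rV[R]_d) (k : R) :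
  enorm e = 1 -> 0 < k -> convex_body (cone e k).
Proof.
move=> e1 k0; split.
- apply: bounded_closed_compact; last exact: closed_cone.
  exists (k + 1); split; first exact: num_real.
  move=> M kM x xK; have x0 := cone_ge0 k0 xK; case: xK => x1 xk.
  apply: le_trans (ltW kM); rewrite -[x](subrK (dot x e *: e)).
  apply: le_trans (ler_normD _ _) (lerD _ _).
    by rewrite (le_trans xk)// ler_piMr// ltW.
  rewrite normrZ ger0_norm// mulr_ile1//.
  by rewrite (le_trans (norm_le_enorm _))// e1.
- have conv (x y : 'rV[R]_d) (t : R) : 0 <= t -> t <= 1 ->
      cone e k x -> cone e k y -> cone e k (t *: x + (1 - t) *: y).
    move=> t0 t1 [x1 xk] [y1 yk]; have t1' : 0 <= 1 - t by lra.
    split; rewrite ?perpD ?perpZ !dotDl !dotZl; first by nra.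
    apply: le_trans (ler_normD _ _) _; rewrite !normrZ !ger0_norm//.
    have := ler_wpM2l t0 xk; have := ler_wpM2l t1' yk; lra.
  by move=> x y l; rewrite !inE; apply: conv; [exact: ge0|exact: le1].
- exists (2^-1 *: e); have := cone_near e1 k0.
  by apply: filterS => x [].
Qed.

(** Moving along [xi] changes the perpendicular part by at least [c] times the change of height,
    while the cone of aperture [c / 3] allows little perpendicular room. The ratio of heights is
    then at most [(1 + 1/3) / (1 - 1/3) = 2]. *)
Lemma cone_chord (R : realType) (d : nat) (e x xi : 'rV[R]_d) (c u : R) :
  0 < c -> c * `|dot xi e| <= `|perp e xi| ->
  cone e (c / 3) x -> cone e (c / 3) (x + u *: xi) ->
  dot (x + u *: xi) e <= 2 * dot x e.
Proof.
move=> c0 xic [_ xk] [_ yk]; set y := x + _ in yk *.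
have yx : y - x = u *: xi by rewrite /y addrC addKr.
have h1 : c * `|dot y e - dot x e| <= `|perp e y - perp e x|.
  have -> : dot y e - dot x e = u * dot xi e.
    by rewrite /y dotDl dotZl addrC addKr.
  have -> : perp e y - perp e x = u *: perp e xi.
    by rewrite /y perpD perpZ addrC addKr.
  by rewrite normrM normrZ mulrCA ler_wpM2l.
(* With the two cone inequalities, the heights differ by at most a third of
   their sum. *)
have h2 := le_trans h1 (ler_normB _ _).
have h3 : c * `|dot y e - dot x e| <= c * ((dot y e + dot x e) / 3).
  by apply: le_trans h2 _; lra.
move: h3; rewrite ler_pM2l// ler_norml; lra.
Qed.

(** * The logarithm of the height *)

Lemma ln_sub_le1 (R : realType) (a b : R) : 0 < a -> 0 < b ->
  a <= 2 * b -> ln a - ln b <= 1.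
Proof.
(* [ln (1 + x) <= x] at [x = 1] gives [ln 2 <= 1]. *)
move=> a0 b0 ab; have := @le_ln1Dx R 1 ltac:(lra).
have : ln a <= ln (2 * b) by rewrite ler_ln ?posrE ?mulr_gt0.
rewrite lnM ?posrE// -[1 + 1]/2; lra.
Qed.

(** The factor [(2 ^+ r)^-1] offsets the sum of binomial coefficients in an [r]-th difference;
    [eta > 0] keeps the logarithm continuous at the tip. *)
Definition cone_log (R : realType) (d : nat) (e : 'rV[R]_d) (r : nat) (eta : R)
    (x : 'rV[R]_d) : R := (2 ^+ r)^-1 * ln (dot x e + eta).

Lemma cone_height_gt0 (R : realType) (d : nat) (e x : 'rV[R]_d) (k eta : R) :
  0 < k -> 0 < eta -> cone e k x -> 0 < dot x e + eta.
Proof. by move=> k0 eta0 /(cone_ge0 k0) h; rewrite ltr_wpDl. Qed.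

Lemma cone_log_Linfty (R : realType) (d r : nat) (e : 'rV[R]_d) (k eta : R) :
  0 < k -> 0 < eta -> Linfty (cone e k) (cone_log e r eta).
Proof.
move=> k0 eta0; rewrite /Linfty /= -(proj1 (closure_id _) (@closed_cone _ _ e k)).
apply: continuous_in_subspaceT => x; rewrite inE => xK.
have h1 : dot y e + eta @[y --> x] --> dot x e + eta.
  exact: (cvgD (@continuous_dot _ _ e x) (cvg_cst _)).
have h2 := continuous_comp h1 (continuous_ln (cone_height_gt0 k0 eta0 xK)).
exact: (cvgM (cvg_cst _) h2).
Qed.

Lemma cone_log_modulus (R : realType) (d r : nat) (E : set 'rV[R]_d)
    (e : 'rV[R]_d) (c eta : R) : (0 < r)%N -> 0 < c -> 0 < eta ->
  (forall xi, E xi -> c * `|dot xi e| <= `|perp e xi|) ->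
  (set_modulus (cone e (c / 3)) E r (cone_log e r eta) <= 1%:E)%E.
Proof.
move=> r0 c0 eta0 Ec; apply: set_modulus_le1 => //; first exact: closed_cone.
have k0 : 0 < c / 3 by rewrite divr_gt0.
move=> x xi u xK Exi yK.
have xy := cone_chord c0 (Ec _ Exi) xK yK.
(* The same chord traversed backwards, with step [- u]. *)
have yx : dot x e <= 2 * dot (x + u *: xi) e.
  rewrite -[x in X in X <= _](addrK (u *: xi)) -scaleNr.
  apply: cone_chord c0 (Ec _ Exi) yK _.
  by rewrite scaleNr addrK.
have px := cone_height_gt0 k0 eta0 xK; have py := cone_height_gt0 k0 eta0 yK.
have p2 : 0 < (2 ^+ r)^-1 :> R by rewrite invr_gt0 exprn_gt0.
rewrite /cone_log -mulrBr normrM gtr0_norm// ler_piMr ?(ltW p2)// ler_norml.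
have h1 : dot x e + eta <= 2 * (dot (x + u *: xi) e + eta) by lra.
have h2 : dot (x + u *: xi) e + eta <= 2 * (dot x e + eta) by lra.
have := ln_sub_le1 px py h1; have := ln_sub_le1 py px h2; lra.
Qed.

(** * Control at the tip, choice of the axis, and conclusion *)

Lemma dir_poly_cone_tip (R : realType) (d r : nat) (E : set 'rV[R]_d)
    (e : 'rV[R]_d) (k : R) : enorm e = 1 -> 0 < k ->
  lin_span E = [set: 'rV[R]_d] ->
  exists2 C : R, 0 <= C & forall (Q : 'rV[R]_d -> R) (B : R), dir_poly E r Q ->
    (forall x, cone e k x -> 4^-1 < dot x e -> `|Q x| <= B) -> `|Q 0| <= C * B.
Proof.
move=> e1 k0 Espan; set p := 2^-1 *: e.
have [rho /= rho0 hrho] := (proj1 (nbhs_ballP _ _) (cone_near e1 k0)).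
(* Translation by [- p] carries the ball about [p] to the tip. *)
have [s sE ps] : lin_span E (- p) by rewrite Espan.
have [C [rho' [C0 rho'0 hC]]] := dir_poly_bound_shift r p sE ps rho0.
exists C => // Q B Qp QB; apply: (hC Q) => //; last by rewrite !subrr normr0.
move=> x xp; have [] := hrho x; last exact: QB.
by rewrite -ball_normE /= distrC.
Qed.

(** A point [e] of the sphere outside the closure has a ball free of [E] and [- E], so [E] keeps a
    positive distance from both [e] and [- e], as [perp_lower_bound] requires. *)
Lemma avoided_direction (R : realType) (d : nat) (E : set 'rV[R]_d) :
  E `<=` @sphere R d -> closure (E `|` [set - x | x in E]) <> @sphere R d ->
  exists e : 'rV[R]_d, exists2 c : R, 0 < c & enorm e = 1 /\
    forall xi, E xi -> c * `|dot xi e| <= `|perp e xi|.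
Proof.
move=> Esph; set A := _ `|` _ => clA.
have Asph : A `<=` @sphere R d.
  move=> x [/Esph//|[y /Esph y1 <-]]; rewrite /sphere /= -y1 /enorm.
  by congr Num.sqrt; apply: eq_bigr => i _; rewrite mxE sqrrN.
have [e [e1 eA]] : exists e, @sphere R d e /\ ~ closure A e.
  apply: contrapT => /forallNP h; apply: clA; apply/seteqP; split=> [|x xs].
    by rewrite [X in _ `<=` X](closure_id _).1; [exact: closureS|exact: closed_sphere].
  by apply: contrapT => xA; exact: (h x).
have [delta delta0 hd] : exists2 delta : R, 0 < delta &
    forall x, A x -> delta <= `|x - e|.
  have : nbhs e (~` A).
    by have : (~` closure A) e by []; rewrite -interiorC.
  move=> /nbhs_ballP[delta /= delta0 hd]; exists delta => // x Ax.
  rewrite leNgt; apply/negP => xe; apply: (hd x) => //.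
  by rewrite -ball_normE /= distrC.
have [c c0 hc] := perp_lower_bound e1 delta0.
exists e, c => //; split => // xi Exi; apply: hc; first exact: Esph.
  by apply: hd; left.
by rewrite -normrN opprD; apply: hd; right; exists xi.
Qed.

Theorem theorem4p1 (R : realType) (d : nat) (E : set 'rV[R]_d) :
  (2 <= d)%N ->
  E `<=` @sphere R d ->
  lin_span E = [set: 'rV[R]_d] ->
  closure (E `|` [set - x | x in E]) <> @sphere R d ->
  exists2 K : set 'rV[R]_d, convex_body K &
    forall r : nat, (0 < r)%N -> whitney_const K E r = +oo%E.
Proof.
move=> _ Esph Espan /(avoided_direction Esph)[e [c c0 [e1 Ec]]].
have k0 : 0 < c / 3 by rewrite divr_gt0.
exists (cone e (c / 3)) => [|r r0]; first exact: convex_body_cone.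
have [C C0 hC] := dir_poly_cone_tip r e1 k0 Espan.
apply: eq_infty => M.
have p2 : 0 < 2 ^+ r :> R by rewrite exprn_gt0.
pose M' := Num.max M 0; have M'0 : 0 <= M' by rewrite le_max lexx orbT.
(* A competitor at distance less than [M'] is at most [M' + 3] in absolute
   value above height 1/4, hence at most [C * (M' + 3)] at the tip. *)
pose T := M' + C * (M' + 3) + 1.
have T0 : 0 <= T by rewrite !addr_ge0// mulr_ge0// addr_ge0.
(* Chosen so that the scaled logarithm equals exactly [- T] at the tip. *)
pose eta := expR (- (2 ^+ r * T)).
have eta0 : 0 < eta := expR_gt0 _.
have eta1 : eta <= 1 by rewrite -expR0 ler_expR oppr_le0 mulr_ge0// ltW.
pose f := cone_log e r eta.
have f0 : f 0 = - T.
  by rewrite /f /cone_log dot0l add0r expRK mulrN mulKf// gt_eqF.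
(* Here [dot x e + eta] lies between 1/4 and 2; applying [ln y <= y - 1] to it and to its inverse
   bounds the logarithm by 1 above and -3 below. *)
have fB x : cone e (c / 3) x -> 4^-1 < dot x e -> `|f x| <= 3.
  move=> [x1 _] x4; have x0 : 0 < dot x e + eta by lra.
  rewrite /f /cone_log normrM gtr0_norm ?invr_gt0//.
  have ln_le y : 0 < y -> ln y <= y - 1 :> R.
    by move=> y0; rewrite -[y in ln y](subrKC 1); apply: le_ln1Dx; lra.
  have lnB : `|ln (dot x e + eta)| <= 3.
    have hu := ln_le _ x0; have xV0 := x0; rewrite -invr_gt0 in xV0.
    have hl := ln_le _ xV0; rewrite lnV ?posrE// in hl.
    have hi : (dot x e + eta)^-1 <= 4.
      by rewrite -[leRHS]invrK lef_pV2 ?posrE//; lra.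
    rewrite ler_norml; lra.
  apply: le_trans lnB; rewrite ler_piMl// invf_le1// exprn_ege1//; lra.
apply: (@le_trans _ _ (best_approx (cone e (c / 3)) E r f)); last first.
  apply: ereal_sup_ubound; exists f => //; split; first exact: cone_log_Linfty.
  exact: cone_log_modulus.
apply: le_ereal_inf_tmp => _ [Q Qp <-]; rewrite leNgt; apply/negP => QM.
have fQ x : cone e (c / 3) x -> `|f x - Q x| <= M'.
  move=> xK; rewrite le_max; apply/orP; left; rewrite -lee_fin.
  apply: le_trans (ltW QM); apply: ereal_sup_ubound; right.
  by exists x => //; exact: subset_closure.
have Q0 : `|Q 0| <= C * (M' + 3).
  apply: hC => // x xK x4; rewrite -[Q x](subKr (f x)) [M' + 3]addrC.
  by apply: le_trans (ler_normB _ _) (lerD _ _); [exact: fB|exact: fQ].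
(* At the tip [Q 0 <= M' - T = - C * (M' + 3) - 1], which contradicts [Q0]. *)
have := fQ 0 (cone_tip _ _); rewrite f0 /T ler_norml; move: Q0.
rewrite ler_norml; lra.
Qed.
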